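(* For each $k\in\{3,4,5,6\}$, there exists a smooth ($C^\infty$) $k$-free immersion of the $2$-torus $\mathbb{T}^2=(\mathbb{R}/2\pi\mathbb{Z})^2$ into $\mathbb{R}^{q_{2,k}}$, where $q_{2,k}=\binom{k+2}{k}-1$ (so $q_{2,3}=9$, $q_{2,4}=14$, $q_{2,5}=20$, $q_{2,6}=27$).
   Context: Given a smooth manifold $M$ of dimension $m$, a smooth map $F:M\to\mathbb{R}^q$ is $k$-free if, in local coordinates on $M$, the vectors of partial derivatives of $F$ of all orders from $1$ up to $k$ (one vector of $\mathbb{R}^q$ for each multi-index $\alpha$ with $1\le|\alpha|\le k$) are linearly independent at every point. The critical dimension for $k$-free maps on $M$, i.e. the number of partial derivatives of order from $1$ to $k$, is $q_{m,k}=\sum_{j=1}^{k}\binom{m+j-1}{j}=\binom{m+k}{k}-1$. *)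

(* Defs.v *)
From HB Require Import structures.
From mathcomp Require Import all_boot all_order all_algebra.
From mathcomp Require Import generic_quotient ring_quotient.
From mathcomp Require Import all_classical all_reals all_analysis.

Set Implicit Arguments.
Unset Strict Implicit.
Unset Printing Implicit Defensive.

Import Order.TTheory GRing.Theory Num.Theory.
Import numFieldNormedType.Exports.

Local Open Scope quotient_scope.
Local Open Scope ring_scope.

(* The subgroup 2 pi Z of R. *)
Definition twopiZ (R : realType) : {pred R} :=
  fun x => x / (pi *+ 2) \is a Num.int.
Arguments twopiZ : clear implicits.

Fact twopiZ_zmod_closed (R : realType) : zmod_closed (twopiZ R).
Proof.
have twopiZE z : (z \in twopiZ R) = (z / (pi *+ 2) \is a Num.int) by [].
split=> [|x y]; rewrite !twopiZE; first by rewrite mul0r rpred0.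
by rewrite mulrBl; apply: rpredB.
Qed.

HB.instance Definition _ (R : realType) :=
  GRing.isZmodClosed.Build R (twopiZ R) (twopiZ_zmod_closed R).

Definition circle (R : realType) : Type := Quotient.quot (twopiZ R).

Definition torus (R : realType) (m : nat) : Type := 'rV[circle R]_m.

Definition torus_proj (R : realType) (m : nat) (x : 'rV[R]_m) : torus R m :=
  map_mx (\pi_(Quotient.quot (twopiZ R))) x.

(* The projection R^m -> T^m is the universal covering, and its local inverses
   form the standard atlas of T^m.  So F \o torus_proj is F read in these
   angular coordinates, around every point of the torus at once. *)
Definition in_coords (R : realType) (m q : nat) (F : torus R m -> 'rV[R]_q) :
    'rV[R]_m -> 'rV[R]_q :=
  F \o @torus_proj R m.

Definition pderiv (R : realType) (m q : nat) (i : 'I_m)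
    (f : 'rV[R]_m -> 'rV[R]_q) : 'rV[R]_m -> 'rV[R]_q :=
  'D_(delta_mx 0 i) f.

(* C^oo: all iterated partial derivatives, in any order, exist and are
   continuous.  Existence has to be asked for explicitly because 'D_v f is a
   total operator. *)
Definition smooth (R : realType) (m q : nat) (f : 'rV[R]_m -> 'rV[R]_q) : Prop :=
  forall s : seq 'I_m, let g := foldr (@pderiv R m q) f s in
    continuous g /\ forall (i : 'I_m) x, derivable g x (delta_mx 0 i).

(* The derivative d^alpha f, with alpha i derivations in the i-th variable. *)
Definition mpderiv (R : realType) (m q : nat) (alpha : 'I_m -> nat)
    (f : 'rV[R]_m -> 'rV[R]_q) : 'rV[R]_m -> 'rV[R]_q :=
  foldr (fun i => iter (alpha i) (@pderiv R m q i)) f (enum 'I_m).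

(* The multi-indices alpha in N^m with 1 <= |alpha| <= k; their entries are
   at most k, so they form a subset of a finite type. *)
Definition multi_indices (m k : nat) : {set {ffun 'I_m -> 'I_k.+1}} :=
  [set alpha : {ffun 'I_m -> 'I_k.+1} |
     (1 <= \sum_(i < m) alpha i <= k)%N].

Definition torus_smooth (R : realType) (m q : nat)
    (F : torus R m -> 'rV[R]_q) : Prop :=
  smooth (in_coords F).

(* 'd is total too; for a smooth F it is the actual differential. *)
Definition torus_immersion (R : realType) (m q : nat)
    (F : torus R m -> 'rV[R]_q) : Prop :=
  forall x : 'rV[R]_m, injective ('d (in_coords F) x).

(* free is about the family of the d^alpha F (x), one vector for each alpha:
   two equal vectors for different alpha make it fail. *)
Definition torus_kfree (R : realType) (m q k : nat)
    (F : torus R m -> 'rV[R]_q) : Prop :=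
  forall x : 'rV[R]_m,
    free [seq mpderiv (fun i => alpha i) (in_coords F) x
         | alpha : {ffun 'I_m -> 'I_k.+1} in multi_indices m k].

(* Main.v *)
Require Import Defs.
From mathcomp Require Import all_boot all_order all_algebra.
From mathcomp Require Import generic_quotient ring_quotient ring lra zify.
From mathcomp Require Import all_classical all_reals all_analysis.

Set Implicit Arguments.
Unset Strict Implicit.
Unset Printing Implicit Defensive.

Import Order.TTheory GRing.Theory Num.Theory.
Import numFieldNormedType.Exports.

Local Open Scope quotient_scope.
Local Open Scope ring_scope.

(** The maps are trigonometric polynomials.  A real differential operator
    P = sum c_ab D1^a D2^b, 1 <= a + b <= k, acts on the exponential of
    frequency w by a scalar, its symbol:

      P e^(i w.x) = (E(w) + i O(w)) e^(i w.x),

    where E and O are real polynomials in w with monomials of even,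
    respectively odd, degree, whose coefficients are those of P up to sign.
    So k-freeness says: if P kills all the components at one point, then E and
    O are zero.

    A pair of components cos(w.x), sin(w.x) forces E(w) = O(w) = 0.  Such pairs
    alone cannot work: they put as many conditions on E as on O, while the
    numbers of monomials of E and O are 3 and 6 for k = 3, 8 and 6 for k = 4,
    8 and 12 for k = 5, 15 and 12 for k = 6.  So all but three or four of the
    components are such pairs, which leaves a space of symbols of dimension
    three or four, and each remaining component is the real or the imaginary
    part of a sum z of two or three exponentials, with coefficients among 1, -1,
    i and -i, or one real sum of two waves.  Their frequencies are chosen such
    that, once z is divided by one of its exponentials, only multiples of one
    angle t are left.  The remaining conditions on (E, O) at x are then a linear
    system whose coefficients depend on t = delta.x only, and whose determinant
    has no zero: up to a constant factor it is sin^2 t + cos^2 2t for k = 5 and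
    6, the value at (sin t, cos 2t) of a positive definite quadratic form that
    depends on t for k = 3, and 6 cos^2 t + 4 sin^2 t + sin t for k = 4.

    [torus_kfree_trig] reduces the theorem to symbols, [annihilated_re_im]
    produces the linear system in t, the lemmas named unisolvent say which
    frequencies determine E and O, and [waves3_free] to [waves6_free] put this
    together for each k. *)

(** * Trigonometric polynomials and their derivatives *)

Definition freq : Type := (int * int)%type.

(** The wave ((p, q), w) stands for Re ((p + i q) e^(i w.x)). *)
Definition wave : Type := ((int * int) * freq)%type.

Definition phase (R : realType) (w : freq) (x : 'rV[R]_2) : R :=
  w.1%:~R * x 0 0 + w.2%:~R * x 0 1.

Definition wave_val (R : realType) (h : wave) (x : 'rV[R]_2) : R :=
  h.1.1%:~R * cos (phase h.2 x) - h.1.2%:~R * sin (phase h.2 x).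

Definition trig_val (R : realType) (z : seq wave) (x : 'rV[R]_2) : R :=
  \sum_(h <- z) wave_val h x.

(** Components beyond the length of L are zero. *)
Definition trig_map (R : realType) (q : nat) (L : seq (seq wave))
    (x : 'rV[R]_2) : 'rV[R]_q := \row_j trig_val (nth [::] L j) x.

Definition mul_i (c : int * int) : int * int := (- c.2, c.1).

Definition freq_at (i : 'I_2) (w : freq) : int := if i == 0 then w.1 else w.2.

Definition scale_amp (n : int) (c : int * int) : int * int := (n * c.1, n * c.2).

Definition wave_der (i : 'I_2) (h : wave) : wave :=
  (scale_amp (freq_at i h.2) (mul_i h.1), h.2).

Section Calculus.
Variable R : realType.
Implicit Types (x v : 'rV[R]_2) (w : freq) (z : seq wave).

Lemma is_derive_coord x v j : is_derive x v (fun y : 'rV[R]_2 => y 0 j) (v 0 j).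
Proof.
have d : derivable (fun y : 'rV[R]_2 => y 0 j) x v.
  exact/diff_derivable/differentiable_coord.
apply: DeriveDef => //.
have := derive_mx (@derivable_id _ _ x v).
by rewrite derive_id => /matrixP /(_ 0 j); rewrite !mxE.
Qed.

Lemma differentiable_phase w x : differentiable (@phase R w) x.
Proof.
rewrite /phase; apply: differentiableD; apply: differentiableM => //;
exact: differentiable_coord.
Qed.

Lemma derive_phase w x v : 'D_v (@phase R w) x = phase w v.
Proof.
have d0 := is_derive_coord x v 0; have d1 := is_derive_coord x v 1.
have -> : @phase R w = w.1%:~R \*: (fun y : 'rV[R]_2 => y 0 0)
    + w.2%:~R \*: (fun y : 'rV[R]_2 => y 0 1).
  by apply/funext => y.
by rewrite derive_val.
Qed.

Lemma derive_comp_phase (f df : R -> R) w x v :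
  (forall t : R, is_derive t 1 f (df t)) ->
  'D_v (fun y => f (phase w y)) x = phase w v * df (phase w x).
Proof.
move=> fE.
have df' t : differentiable f t by apply/derivable1_diffP; case: (fE t).
have dp := differentiable_phase w x.
have dc : differentiable (f \o phase w) x by exact: differentiable_comp.
rewrite deriveE // diff_comp //= -[X in 'd f _ X]deriveE // derive_phase.
rewrite deriv1E; last by case: (fE (phase w x)).
by rewrite derive1E derive_val.
Qed.

Lemma differentiable_comp_phase (f : R -> R) w x :
  (forall t : R, derivable f t 1) -> differentiable (fun y => f (phase w y)) x.
Proof.
move=> fd; apply: (@differentiable_comp _ _ _ _ (@phase R w) f) => //.
- exact: differentiable_phase.
- exact/derivable1_diffP.
Qed.

Lemma differentiable_wave h x : differentiable (@wave_val R h) x.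
Proof.
apply: differentiableB; apply: differentiableM => //;
by apply: differentiable_comp_phase => t.
Qed.

Lemma phase_delta w i : @phase R w (delta_mx 0 i) = (freq_at i w)%:~R.
Proof.
rewrite /phase /freq_at !mxE /=; case: i => [[|[|//]]] ilt /=.
- by rewrite mulr1 mulr0 addr0.
- by rewrite mulr1 mulr0 add0r.
Qed.

Lemma pderiv_wave i h x :
  'D_(delta_mx 0 i) (@wave_val R h) x = wave_val (wave_der i h) x.
Proof.
case: h => -[p q] w.
have dc := @differentiable_comp_phase cos w x (@derivable_cos R).
have ds := @differentiable_comp_phase sin w x (@derivable_sin R).
pose C (y : 'rV[R]_2) : R := cos (phase w y).
pose S (y : 'rV[R]_2) : R := sin (phase w y).
have dC : derivable C x (delta_mx 0 i) by exact: diff_derivable.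
have dS : derivable S x (delta_mx 0 i) by exact: diff_derivable.
have -> : @wave_val R (p, q, w) = (p%:~R \*: C) - (q%:~R \*: S) by [].
have dpC : derivable (p%:~R \*: C) x (delta_mx 0 i) by exact: derivableZ.
have dqS : derivable (q%:~R \*: S) x (delta_mx 0 i) by exact: derivableZ.
rewrite (deriveB dpC dqS).
rewrite (deriveZ _ dC) (deriveZ _ dS).
rewrite (derive_comp_phase _ _ _ (fun t => is_derive_cos t)).
rewrite (derive_comp_phase _ _ _ (fun t => is_derive_sin t)).
rewrite phase_delta /wave_val /= /GRing.scale /= !rmorphM /= rmorphN /=.
ring.
Qed.

Definition trig_der i z := map (wave_der i) z.

Lemma differentiable_trig z x : differentiable (@trig_val R z) x.
Proof.
elim: z => [|h z IH].
  have -> : @trig_val R [::] = cst 0.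
    by apply/funext => y; rewrite /trig_val big_nil.
  exact: differentiable_cst.
have -> : @trig_val R (h :: z) = @wave_val R h + @trig_val R z.
  by apply/funext => y; rewrite /trig_val big_cons.
by apply: differentiableD => //; exact: differentiable_wave.
Qed.

Lemma pderiv_trig i z x :
  'D_(delta_mx 0 i) (@trig_val R z) x = trig_val (trig_der i z) x.
Proof.
elim: z => [|h z IH].
  have -> : @trig_val R [::] = cst 0.
    by apply/funext => y; rewrite /trig_val big_nil.
  exact: derive_cst.
have -> : @trig_val R (h :: z) = @wave_val R h + @trig_val R z.
  by apply/funext => y; rewrite /trig_val big_cons.
rewrite deriveD; last 2 first.
- exact/diff_derivable/differentiable_wave.
- exact/diff_derivable/differentiable_trig.
by rewrite pderiv_wave IH /trig_val /trig_der /= big_cons.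
Qed.

Lemma derivable_trig_map q L x v : derivable (@trig_map R q L) x v.
Proof.
apply/derivable_mxP => i j; rewrite /trig_map.
under eq_fun do rewrite mxE.
exact/diff_derivable/differentiable_trig.
Qed.

Lemma differentiable_trig_map q L x : differentiable (@trig_map R q L) x.
Proof.
have -> : @trig_map R q L =
    \sum_(j < q) (fun y => trig_val (nth [::] L j) y *: delta_mx 0 j).
  apply/funext => y; rewrite fct_sumE [LHS]row_sum_delta.
  by apply: eq_bigr => j _; rewrite mxE.
apply: differentiable_sum => j; apply: differentiableZl.
exact: differentiable_trig.
Qed.

Lemma pderiv_trig_map q L i :
  pderiv i (@trig_map R q L) = trig_map q (map (trig_der i) L).
Proof.
apply/funext => x; rewrite /pderiv derive_mx; last exact: derivable_trig_map.
apply/matrixP => a j; rewrite !mxE.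
under [X in 'D__ X _]eq_fun do rewrite mxE.
rewrite pderiv_trig; congr (trig_val _ x).
have [jL|Lj] := ltnP j (size L); first by rewrite (nth_map [::]).
by rewrite !nth_default ?size_map.
Qed.

Lemma smooth_trig_map q L : smooth (@trig_map R q L).
Proof.
have iterE s : foldr (@pderiv R 2 q) (trig_map q L) s =
    trig_map q (foldr (fun i => map (trig_der i)) L s).
  by elim: s => //= i s ->; rewrite pderiv_trig_map.
move=> s /=; rewrite iterE; split => [x|i x].
- exact/differentiable_continuous/differentiable_trig_map.
- exact: derivable_trig_map.
Qed.

End Calculus.

(** * Differential operators as symbols *)

Section Symbols.
Variable R : realType.
Implicit Types (x v : 'rV[R]_2) (w : freq) (z : seq wave).

Lemma iter_pderiv_trig_map q L i n :
  iter n (@pderiv R 2 q i) (trig_map q L) =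
  trig_map q (map (iter n (trig_der i)) L).
Proof.
elim: n => [|n IH] /=; first by rewrite map_id.
by rewrite IH pderiv_trig_map -map_comp.
Qed.

Definition trig_mder (a b : nat) z :=
  iter a (trig_der 0) (iter b (trig_der 1) z).

Lemma mpderiv_trig_map q L (alpha : 'I_2 -> nat) x :
  mpderiv alpha (@trig_map R q L) x =
  \row_j trig_val (trig_mder (alpha 0) (alpha 1) (nth [::] L j)) x.
Proof.
have iter_nil (i : 'I_2) n : iter n (trig_der i) [::] = [::].
  by elim: n => //= n ->.
have -> : mpderiv alpha (@trig_map R q L) =
    trig_map q (map (trig_mder (alpha 0) (alpha 1)) L).
  rewrite /mpderiv enum_ordSl enum_ordSl /= enum_ord0 /=.
  have -> : lift ord0 ord0 = 1 :> 'I_2 by exact/val_inj.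
  by rewrite !iter_pderiv_trig_map -map_comp.
apply/rowP => j; rewrite !mxE; congr (trig_val _ x).
have [jL|Lj] := ltnP j (size L); first by rewrite (nth_map [::]).
by rewrite !nth_default ?size_map // /trig_mder !iter_nil.
Qed.

Lemma iter_wave_der i n h : iter n (wave_der i) h =
  (scale_amp (freq_at i h.2 ^+ n) (iter n mul_i h.1), h.2).
Proof.
elim: n => [|n IH] /=.
  by case: h => -[p q] w /=; rewrite /scale_amp !mul1r.
rewrite IH /wave_der /= exprS; congr (_, _).
by rewrite /scale_amp /mul_i /= !mulrN !mulrA.
Qed.

Lemma iter_mul_i_scale n m c :
  iter n mul_i (scale_amp m c) = scale_amp m (iter n mul_i c).
Proof. by elim: n => //= n ->; rewrite /scale_amp /mul_i /= mulrN. Qed.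

(** i^n is a sign times 1 or i, according to the parity of n; this is what
    splits the symbol of an operator into an even and an odd real part. *)
Lemma wave_val_iter_mul_i n c w x :
  wave_val (iter n mul_i c, w) x =
  (-1) ^+ n./2 * wave_val (if odd n then mul_i c else c, w) x.
Proof.
have mul_i2 m d : iter m.*2 mul_i d = scale_amp ((-1) ^+ m) d.
  elim: m d => [|m IH] [p q] /=; first by rewrite /scale_amp !mul1r.
  by rewrite IH /mul_i /scale_amp /= exprS !mulN1r !mulNr.
rewrite -{1}(odd_double_half n) iterD mul_i2.
have -> : iter (odd n) mul_i (scale_amp ((-1) ^+ n./2) c) =
    scale_amp ((-1) ^+ n./2) (if odd n then mul_i c else c).
  by rewrite iter_mul_i_scale; case: (odd n).
by rewrite /wave_val /scale_amp /= !rmorphM /= rmorphXn /= rmorphN1 mulrBr !mulrA.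
Qed.

Lemma trig_val_mder a b z x :
  trig_val (trig_mder a b z) x =
  \sum_(h <- z) (-1) ^+ (a + b)./2 * (h.2.1%:~R ^+ a * h.2.2%:~R ^+ b) *
     wave_val (if odd (a + b) then mul_i h.1 else h.1, h.2) x.
Proof.
have iter_map (i : 'I_2) n l :
    iter n (trig_der i) l = map (iter n (wave_der i)) l.
  elim: n => [|n IH] /=; first by rewrite map_id.
  by rewrite IH /trig_der -map_comp.
rewrite /trig_mder !iter_map -map_comp /trig_val big_map; apply: eq_bigr => h _.
rewrite /= !iter_wave_der /= iter_mul_i_scale -iterD.
set c := iter _ _ _.
have -> : wave_val (scale_amp (h.2.1 ^+ a) (scale_amp (h.2.2 ^+ b) c), h.2) x =
    (h.2.1%:~R ^+ a * h.2.2%:~R ^+ b) * wave_val (c, h.2) x.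
  by rewrite /wave_val /scale_amp /= !rmorphM /= !rmorphXn /=; ring.
by rewrite wave_val_iter_mul_i; ring.
Qed.

Definition monomials (k : nat) : seq (nat * nat) :=
  [seq ab <- allpairs pair (iota 0 k.+1) (iota 0 k.+1)
     | (1 <= ab.1 + ab.2 <= k)%N].

Lemma mem_monomials k ab : (ab \in monomials k) = (1 <= ab.1 + ab.2 <= k)%N.
Proof.
rewrite mem_filter andb_idr // => /andP[_ abk]; case: ab abk => a b abk.
apply/allpairsP; exists (a, b); rewrite !mem_iota !add0n !ltnS; split => //.
- exact: leq_trans (leq_addr b a) abk.
- exact: leq_trans (leq_addl a b) abk.
Qed.

Lemma monomials_uniq k : uniq (monomials k).
Proof.
by apply/filter_uniq/allpairs_uniq; rewrite ?iota_uniq // => -[a b] [c d].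
Qed.

Definition parity_monomials (b : bool) (k : nat) : seq (nat * nat) :=
  [seq ab <- monomials k | odd (ab.1 + ab.2) == b].

(** The polynomial E (b = false) or O (b = true), evaluated at w. *)
Definition symbol (b : bool) (k : nat) (e : nat -> nat -> R) (w : freq) : R :=
  \sum_(ab <- parity_monomials b k)
    e ab.1 ab.2 * (w.1%:~R ^+ ab.1 * w.2%:~R ^+ ab.2).

Definition symbol_act k e z x : R :=
  \sum_(h <- z) (symbol false k e h.2 * wave_val h x
                + symbol true k e h.2 * wave_val (mul_i h.1, h.2) x).

(** The coefficients of the symbol are those of the operator, up to the sign of
    i^(a + b). *)
Lemma sum_trig_mder_symbol k (c : nat -> nat -> R) z x :
  \sum_(ab <- monomials k) c ab.1 ab.2 * trig_val (trig_mder ab.1 ab.2 z) x =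
  symbol_act k (fun a b => (-1) ^+ (a + b)./2 * c a b) z x.
Proof.
under eq_bigr => ab _ do rewrite trig_val_mder mulr_sumr.
rewrite exchange_big /=; apply: eq_bigr => h _.
rewrite (bigID (fun ab => odd (ab.1 + ab.2) == false)) /=; congr (_ + _).
  rewrite /symbol big_filter mulr_suml; apply: eq_bigr => ab /eqP ->.
  by case: h => c0 w /=; ring.
rewrite /symbol big_filter mulr_suml.
apply: eq_big => [ab|ab]; first by case: odd.
by case: odd => // _; ring.
Qed.

Lemma big_pick (T : eqType) (V : nmodType) (r : seq T) (t : T) (P : pred T)
    (F : T -> V) :
  uniq r -> t \in r -> {in r, P =1 pred1 t} -> \sum_(i <- r | P i) F i = F t.
Proof.
move=> ru tr Pt; rewrite big_mkcond (bigD1_seq t) //= Pt //= eqxx.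
rewrite big_seq_cond big1 ?addr0 // => i /andP[ir /negbTE it].
by rewrite Pt //= it.
Qed.

Definition annihilated k (e : nat -> nat -> R) x (L : seq (seq wave)) : Prop :=
  forall z, z \in L -> symbol_act k e z x = 0.

(** By [sum_trig_mder_symbol], this is the linear independence over R of the
    partial derivatives of orders 1 to k, at every point. *)
Definition symbol_free k (L : seq (seq wave)) : Prop :=
  forall x (e : nat -> nat -> R), annihilated k e x L ->
  forall a b, (1 <= a + b <= k)%N -> e a b = 0.

Lemma symbol_free_comb k q L x (c : nat -> nat -> R) :
  symbol_free k L -> size L = q ->
  \sum_(ab <- monomials k) c ab.1 ab.2 *:
     (\row_(j < q) trig_val (trig_mder ab.1 ab.2 (nth [::] L j)) x) = 0 ->
  forall a b, (1 <= a + b <= k)%N -> c a b = 0.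
Proof.
move=> Lfree Lq c0 a b abk.
have /(_ (fun a b => (-1) ^+ (a + b)./2 * c a b)) := Lfree x.
have L0 z : z \in L ->
    symbol_act k (fun a b => (-1) ^+ (a + b)./2 * c a b) z x = 0.
  move=> /(nthP [::])[j jL <-]; rewrite Lq in jL.
  move/rowP/(_ (Ordinal jL)) : c0; rewrite summxE mxE => <-.
  by rewrite -sum_trig_mder_symbol; apply: eq_bigr => ab' _; rewrite !mxE.
by move=> /(_ L0 a b abk)/eqP; rewrite mulf_eq0 signr_eq0 => /eqP.
Qed.

Lemma trig_map_free k q L x : symbol_free k L -> size L = q ->
  free [seq mpderiv (fun i => alpha i) (@trig_map R q L) x
       | alpha : {ffun 'I_2 -> 'I_k.+1} in multi_indices 2 k].
Proof.
move=> Lfree Lq; set A := multi_indices 2 k.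
pose ix (alpha : {ffun 'I_2 -> 'I_k.+1}) : nat * nat :=
  (alpha 0 : nat, alpha 1 : nat).
have ixA alpha : alpha \in A -> ix alpha \in monomials k.
  by rewrite inE big_ord_recl big_ord1 mem_monomials /ix /=;
     have -> : lift ord0 ord0 = 1 :> 'I_2 by exact/val_inj.
have ix_inj : injective ix.
  move=> u v [/val_inj u0 /val_inj u1]; apply/ffunP => i.
  by case: i => [[|[|//]]] ilt; [have -> : Ordinal ilt = 0 by exact/val_inj
    | have -> : Ordinal ilt = 1 by exact/val_inj].
pose D (ab : nat * nat) : 'rV[R]_q :=
  \row_j trig_val (trig_mder ab.1 ab.2 (nth [::] L j)) x.
apply/(@freeP _ _ _ (image_tuple _ _)) => kap kap0 i.
pose al (i : 'I_#|A|) := enum_val i.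
(* The coefficient family indexed by an enumeration of multi-indices, read as
   a family indexed by pairs; ix is injective, so each sum has one term. *)
pose c a b := \sum_(i < #|A| | ix (al i) == (a, b)) kap i.
have csum : \sum_(ab <- monomials k) c ab.1 ab.2 *: D ab = 0.
  rewrite -[RHS]kap0.
  under eq_bigr => ab _ do rewrite /c scaler_suml.
  rewrite (exchange_big_dep predT) //=; apply: eq_bigr => j _.
  rewrite (big_pick (t := ix (al j))) ?monomials_uniq ?ixA ?enum_valP //.
    congr (_ *: _); rewrite (nth_map (al j)) -?cardE ?ltn_ord //.
    by rewrite -enum_val_nth mpderiv_trig_map.
have /andP ixi : (1 <= (ix (al i)).1 + (ix (al i)).2 <= k)%N.
  by rewrite -mem_monomials ixA // enum_valP.
have := symbol_free_comb Lfree Lq csum; move=> /(_ _ _ (introT andP ixi)).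
rewrite /c -surjective_pairing (big_pick (t := i)) //; last first.
- by move=> j _ /=; rewrite (inj_eq ix_inj) (inj_eq enum_val_inj).
- exact: mem_index_enum.
- exact: index_enum_uniq.
Qed.

(** A vector v in the kernel of the differential is a linear relation between
    the two first order derivatives. *)
Lemma trig_map_immersion k q L x : (0 < k)%N -> symbol_free k L -> size L = q ->
  injective ('d (@trig_map R q L) x).
Proof.
move=> k0 Lfree Lq.
have ker0 v : 'd (@trig_map R q L) x v = 0 -> v = 0.
  move=> dv0.
  pose c a b := v 0 0 *+ ((a, b) == (1, 0)%N) + v 0 1 *+ ((a, b) == (0, 1)%N).
  have mono ab : ab \in [:: (1, 0)%N; (0, 1)%N] -> ab \in monomials k.
    by rewrite !inE mem_monomials => /orP[] /eqP ->.
  suff c0 : forall a b, (1 <= a + b <= k)%N -> c a b = 0.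
    have := c0 1%N 0%N k0; rewrite /c /= addr0 => v0.
    have := c0 0%N 1%N k0; rewrite /c /= add0r => v1.
    apply/rowP => i; rewrite mxE.
    by case: i => [[|[|//]]] ilt; [rewrite -[RHS]v0|rewrite -[RHS]v1];
       congr (v _ _); exact/val_inj.
  apply: (symbol_free_comb (x := x) Lfree Lq); rewrite -[RHS]dv0.
  pose D (ab : nat * nat) : 'rV[R]_q :=
    \row_j trig_val (trig_mder ab.1 ab.2 (nth [::] L j)) x.
  under eq_bigr => ab _ do
    rewrite /c -surjective_pairing scalerDl -/(D ab).
  rewrite big_split /=.
  have pick (ab : nat * nat) (r : R) : ab \in monomials k ->
      \sum_(t <- monomials k) (r *+ (t == ab)) *: D t = r *: D ab.
    move=> abk; rewrite -(@big_pick _ _ (monomials k) ab (pred1 ab)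
      (fun t => r *: D t)) ?monomials_uniq // [RHS]big_mkcond /=.
    by apply: eq_bigr => t _; case: eqP; rewrite ?mulr1n // mulr0n scale0r.
  rewrite !pick; last 2 first.
  - by apply: mono; rewrite !inE.
  - by apply: mono; rewrite !inE.
  have vE : v = v 0 0 *: delta_mx 0 0 + v 0 1 *: delta_mx 0 1.
    rewrite {1}(row_sum_delta v) big_ord_recl big_ord1.
    by have -> : lift ord0 ord0 = 1 :> 'I_2 by exact/val_inj.
  have dE i : 'd (@trig_map R q L) x (delta_mx 0 i) =
      trig_map q (map (trig_der i) L) x.
    rewrite -deriveE; last exact: differentiable_trig_map.
    by rewrite -pderiv_trig_map.
  rewrite [in RHS]vE linearD !linearZ /= !dE; congr (_ *: _ + _ *: _);
    apply/rowP => j; rewrite !mxE (nth_map [::]) ?Lq //.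
move=> u v uv; apply/eqP; rewrite -subr_eq0; apply/eqP/ker0.
by rewrite linearB /= uv subrr.
Qed.

(** Any choice of representatives will do, since trig_map is 2 pi-periodic in
    both variables. *)
Definition torus_trig_map q L (t : torus R 2) : 'rV[R]_q :=
  trig_map q L (map_mx repr t).

Lemma trig_periodic (f : R -> R) (n : int) :
  (forall u, f (u + pi *+ 2) = f u) -> forall u, f (u + n%:~R * (pi *+ 2)) = f u.
Proof.
move=> fp u; case: n => n.
  by rewrite -pmulrn mulr_natl (periodicn fp).
rewrite NegzE mulrNz mulNr -pmulrn mulr_natl.
by rewrite -[in RHS](subrK (pi *+ 2 *+ n.+1) u) (periodicn fp).
Qed.

Lemma wave_periodic h x x' :
  (forall j, exists n : int, x' 0 j = x 0 j + n%:~R * (pi *+ 2)) ->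
  wave_val h x' = wave_val h x.
Proof.
case: h => c w xx'; have [m x0] := xx' 0; have [n x1] := xx' 1.
have ph : phase w x' = phase w x + (w.1 * m + w.2 * n)%:~R * (pi *+ 2).
  by rewrite /phase x0 x1 rmorphD !rmorphM /=; ring.
rewrite /wave_val /= ph.
by rewrite (trig_periodic (f := cos)) ?(trig_periodic (f := sin)) // => u;
   rewrite ?cosD2pi ?sinD2pi.
Qed.

Lemma in_coords_torus_trig_map q L :
  in_coords (@torus_trig_map q L) = @trig_map R q L.
Proof.
apply/funext => x; apply/rowP => j; rewrite !mxE.
apply: eq_bigr => h _; apply: wave_periodic => i; rewrite !mxE.
set y := x 0 i.
have : repr (\pi_(Quotient.quot (twopiZ R)) y) - y \in twopiZ R.
  by rewrite Quotient.idealrBE reprK.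
move=> /intrP[n nE].
exists n; rewrite -nE divfK; first by rewrite addrC subrK.
by rewrite mulrn_eq0 /= gt_eqF // pi_gt0.
Qed.

Lemma torus_kfree_trig k q L : (0 < k)%N -> symbol_free k L -> size L = q ->
  [/\ torus_smooth (@torus_trig_map q L), torus_immersion (@torus_trig_map q L)
    & torus_kfree k (@torus_trig_map q L)].
Proof.
move=> k0 Lfree Lq.
split; rewrite /torus_smooth /torus_immersion /torus_kfree
  in_coords_torus_trig_map.
- exact: smooth_trig_map.
- by move=> x; exact: trig_map_immersion Lfree Lq.
- by move=> x; exact: trig_map_free.
Qed.

End Symbols.

(** * Conditions imposed by exponentials *)

Definition exp_wave (w : freq) : seq wave := [:: ((1, 0), w)].

(** The imaginary part of z is the real part of -i z. *)
Definition re_im (z : seq wave) : seq (seq wave) :=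
  [:: z; [seq ((h.1.2, - h.1.1), h.2) | h <- z]].

Definition exp_waves (W : seq freq) : seq (seq wave) :=
  flatten [seq re_im (exp_wave w) | w <- W].

Section Annihilation.
Variable R : realType.
Implicit Types (x v : 'rV[R]_2) (w : freq) (z : seq wave) (e : nat -> nat -> R).

(** Real and imaginary parts of (E + i O)(w) (p + i q). *)
Definition re_coef k e (h : wave) : R :=
  symbol false k e h.2 * h.1.1%:~R - symbol true k e h.2 * h.1.2%:~R.

Definition im_coef k e (h : wave) : R :=
  symbol false k e h.2 * h.1.2%:~R + symbol true k e h.2 * h.1.1%:~R.

Lemma symbol_actE k e z x : symbol_act k e z x =
  \sum_(h <- z) (re_coef k e h * cos (phase h.2 x) -
                 im_coef k e h * sin (phase h.2 x)).
Proof.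
apply: eq_bigr => -[[p q] w] _.
by rewrite /re_coef /im_coef /wave_val /mul_i /= rmorphN /=; ring.
Qed.

(** The two components of z say that a complex number vanishes, so it may be
    multiplied by e^(-i t). *)
Lemma annihilated_re_im k e x z t : annihilated k e x (re_im z) ->
  \sum_(h <- z) (re_coef k e h * cos (phase h.2 x - t) -
                 im_coef k e h * sin (phase h.2 x - t)) = 0 /\
  \sum_(h <- z) (re_coef k e h * sin (phase h.2 x - t) +
                 im_coef k e h * cos (phase h.2 x - t)) = 0.
Proof.
move=> zv.
pose S := \sum_(h <- z) (re_coef k e h * cos (phase h.2 x) -
                         im_coef k e h * sin (phase h.2 x)).
pose T := \sum_(h <- z) (re_coef k e h * sin (phase h.2 x) +
                         im_coef k e h * cos (phase h.2 x)).
have S0 : S = 0 by rewrite -[RHS](zv z) ?symbol_actE // inE eqxx.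
have T0 : T = 0.
  rewrite -[RHS](zv [seq ((h.1.2, - h.1.1), h.2) | h <- z]); last first.
    by rewrite !inE eqxx orbT.
  rewrite symbol_actE big_map; apply: eq_bigr => -[[p q] w] _.
  by rewrite /re_coef /im_coef /= rmorphN /=; ring.
split.
- transitivity (cos t * S + sin t * T); last by rewrite S0 T0 !mulr0 addr0.
  rewrite !mulr_sumr -big_split; apply: eq_bigr => h _ /=.
  by rewrite cosB sinB; ring.
- transitivity (cos t * T - sin t * S); last by rewrite S0 T0 !mulr0 subr0.
  rewrite !mulr_sumr -sumrB; apply: eq_bigr => h _ /=.
  by rewrite cosB sinB; ring.
Qed.

Lemma annihilated_cat k e x L1 L2 :
  annihilated k e x (L1 ++ L2) -> annihilated k e x L1 /\ annihilated k e x L2.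
Proof. by move=> v; split=> z zL; apply: v; rewrite mem_cat zL ?orbT. Qed.

(** Dividing by e^(i w.x) leaves E(w) + i O(w) = 0. *)
Lemma annihilated_exp k e x (W : seq freq) :
  annihilated k e x (exp_waves W) ->
  forall b w, w \in W -> symbol b k e w = 0.
Proof.
move=> v b w wW.
have [|] := @annihilated_re_im k e x (exp_wave w) (phase w x).
  by move=> z zw; apply: v; apply/flattenP; exists (re_im (exp_wave w)) => //;
     exact: map_f.
rewrite !big_seq1 subrr cos0 sin0 !mulr0 !mulr1 subr0 add0r.
rewrite /re_coef /im_coef /= !mulr1 !mulr0 subr0 add0r.
by case: b.
Qed.

Definition part_eq0 b k e : Prop :=
  forall ab, ab \in parity_monomials b k -> e ab.1 ab.2 = 0.

Lemma symbol_eq0 b k e w : part_eq0 b k e -> symbol b k e w = 0.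
Proof.
by move=> e0; rewrite /symbol big_seq big1 // => ab /e0 ->; rewrite mul0r.
Qed.

Lemma coef_eq0 k e : part_eq0 false k e -> part_eq0 true k e ->
  forall a b, (1 <= a + b <= k)%N -> e a b = 0.
Proof.
move=> e0 e1 a b abk.
have := mem_filter (fun ab => odd (ab.1 + ab.2) == odd (a + b)) (a, b)
  (monomials k).
rewrite eqxx mem_monomials abk /=.
by case: (odd (a + b)); [exact: (e1 (a, b))|exact: (e0 (a, b))].
Qed.

End Annihilation.

(** * Symbols that vanish on vertical lines of frequencies *)

Section Lines.
Variable R : realType.
Implicit Type e : nat -> nat -> R.

(** The coefficient of the j-th power of the second coordinate in the symbol, as
    a polynomial in the first coordinate. *)
Definition column b k e j : {poly R} :=
  \poly_(i < k.+1) (if (i, j) \in parity_monomials b k then e i j else 0).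

Lemma mem_parity_monomials b k i j :
  ((i, j) \in parity_monomials b k) = (odd (i + j) == b) && (1 <= i + j <= k)%N.
Proof. by rewrite mem_filter mem_monomials. Qed.

Lemma coef_column b k e i j : (column b k e j)`_i =
  if (i, j) \in parity_monomials b k then e i j else 0.
Proof.
rewrite coef_poly; case: ltnP => // ki.
rewrite mem_parity_monomials; case: ifP => // /andP[_ /andP[_ ijk]].
by have := leq_trans (leq_trans ki (leq_addr j i)) ijk; rewrite ltnn.
Qed.

Lemma symbol_columns b k e w : symbol b k e w =
  \sum_(j < k.+1) (column b k e j).[w.1%:~R] * w.2%:~R ^+ j.
Proof.
under eq_bigr => j _ do rewrite horner_poly mulr_suml.
rewrite exchange_big /symbol big_filter /monomials big_filter_cond.
rewrite big_mkcond big_allpairs.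
have -> : iota 0 k.+1 = index_iota 0 k.+1 by rewrite /index_iota subn0.
rewrite big_mkord; apply: eq_bigr => i _.
rewrite big_mkord; apply: eq_bigr => j _.
rewrite mem_parity_monomials andbC.
by case: ifP => _; rewrite ?mul0r // mulrA.
Qed.

(** On the line of first coordinate s, the symbol is a polynomial in the second
    coordinate, with at most size T coefficients and with size T roots. *)
Lemma line_columns b k e (s : int) (T : seq int) : uniq T ->
  (forall j, (size T <= j)%N -> column b k e j = 0) ->
  (forall t, t \in T -> symbol b k e (s, t) = 0) ->
  forall j, (column b k e j).[s%:~R] = 0.
Proof.
move=> Tu col0 sT j.
pose p := \poly_(j < size T) (column b k e j).[s%:~R].
have pE t : p.[t%:~R] = symbol b k e (s, t).
  rewrite symbol_columns horner_poly /=.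
  pose F j := (column b k e j).[s%:~R] * (t%:~R : R) ^+ j.
  have F0 i : (size T <= i)%N -> F i = 0.
    by move=> /col0; rewrite /F => ->; rewrite horner0 mul0r.
  have Fk i : (k.+1 <= i)%N -> F i = 0.
    move=> ki; rewrite /F.
    suff -> : column b k e i = 0 by rewrite horner0 mul0r.
    apply/polyP => l; rewrite coef_column coef0 mem_parity_monomials.
    case: ifP => // /andP[_ /andP[_ lik]].
    by have := leq_trans (leq_trans ki (leq_addl l i)) lik; rewrite ltnn.
  rewrite -(big_mkord predT F) -[RHS](big_mkord predT F).
  have extend m n : (m <= n)%N -> (forall i, (m <= i)%N -> F i = 0) ->
      \sum_(0 <= i < m) F i = \sum_(0 <= i < n) F i.
    move=> mn Fm; rewrite (big_cat_nat _ (n := m) (p := n)) //=.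
    rewrite [X in _ + X]big_nat_cond [X in _ + X]big1 ?addr0 //.
    by move=> i /andP[/andP[/Fm]].
  by case/orP: (leq_total (size T) k.+1) => le; [|symmetry]; exact: extend.
have p0 : p = 0.
  apply: (@roots_geq_poly_eq0 _ _ (map intr T)).
  - by apply/allP => _ /mapP[t tT ->]; rewrite rootE pE sT.
  - by rewrite map_inj_uniq //; exact: intr_inj.
  - by rewrite size_map size_poly.
have [jT|Tj] := ltnP j (size T); last by rewrite col0 // horner0.
have := coef_poly (size T) (fun j => (column b k e j).[s%:~R]) j.
by rewrite -/p p0 coef0 jT.
Qed.

Lemma column_parity b k e j (s : R) :
  (column b k e j).[- s] = (-1) ^+ (odd j (+) b) * (column b k e j).[s].
Proof.
rewrite !horner_poly mulr_sumr; apply: eq_bigr => i _.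
rewrite mem_parity_monomials.
case: ifP => [/andP[/eqP <- _]|_]; last by rewrite !mul0r mulr0.
by rewrite oddD addbCA addbb addbF signr_odd [(- s) ^+ i]exprNn; ring.
Qed.

Lemma size_column b k e j : (size (column b k e j) <= k.+1 - j)%N.
Proof.
apply/leq_sizeP => i ij; rewrite coef_column mem_parity_monomials.
by case: ifP => // /andP[_ /andP[_ ijk]]; lia.
Qed.

(** A column is even or odd, so every positive root comes with its opposite,
    and a column of index j has degree at most k - j. *)
Lemma column_eq0 b k e j (S : seq int) : uniq S ->
  (forall s, s \in S -> 0 < s) ->
  (forall s, s \in S -> (column b k e j).[s%:~R] = 0) ->
  (k < j + (size S).*2)%N ||
    ((column b k e j).[0] == 0) && (k <= j + (size S).*2)%N ->
  column b k e j = 0.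
Proof.
move=> Su Spos S0 jk.
pose rs : seq R := map intr S ++ map (fun s => - s%:~R) S.
have rs0 : all (root (column b k e j)) rs.
  rewrite all_cat; apply/andP; split; apply/allP => _ /mapP[s sS ->];
    by rewrite rootE ?column_parity S0 // mulr0.
have rs_neq0 r : r \in rs -> r != 0.
  rewrite mem_cat => /orP[] /mapP[s /Spos s0 ->];
  by rewrite ?oppr_eq0 intr_eq0 gt_eqF.
have rs_uniq : uniq rs.
  rewrite cat_uniq !map_inj_uniq ?Su /=; last 2 first.
  - by move=> s t /oppr_inj/intr_inj.
  - exact: intr_inj.
  rewrite andbT; apply/hasPn => _ /mapP[s sS ->]; apply/negP => /mapP[t tS].
  rewrite -rmorphN /= => /intr_inj st.
  by have := Spos _ tS; rewrite -st oppr_gt0 ltNge (ltW (Spos _ sS)).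
have rs_size : size rs = (size S).*2 by rewrite size_cat !size_map addnn.
have szc := size_column b k e j.
case/orP: jk => [jk|/andP[col0 jk]].
  apply: (roots_geq_poly_eq0 rs0 rs_uniq).
  by rewrite rs_size (leq_trans szc) //; lia.
apply: (@roots_geq_poly_eq0 _ _ (0 :: rs)).
- by rewrite /= rs0 andbT.
- by rewrite /= rs_uniq andbT; apply/negP => /rs_neq0; rewrite eqxx.
- by rewrite /= rs_size (leq_trans szc) //; lia.
Qed.

(** Either by parity, or because symbols have no constant term. *)
Lemma column0_root b k e : (column b k e 0).[0] == 0.
Proof. by rewrite horner_coef0 coef_column mem_parity_monomials andbF. Qed.

Definition line_points (W : seq (int * seq int)) : seq freq :=
  [seq (l.1, t) | l <- W, t <- l.2].

(** The pair (s, T) stands for the points of the line of first coordinate s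
    with second coordinates in T.  Each line already used kills two more columns,
    so that the next one needs two points fewer. *)
Definition enough_lines k (W : seq (int * seq int)) : bool :=
  [&& uniq (unzip1 W), all (fun l => (0 < l.1) && uniq l.2) W &
   all (fun i => k.+1 <= size (nth (0%R, [::]) W i).2 + i.*2)%N
     (iota 0 (size W))].

(** By induction on the lines: if all the columns vanish at the r lines already
    used, then the columns of index j > k - 2 r are zero by [column_eq0], and the
    points of the next line suffice for the others by [line_columns]. *)
Lemma line_columns_eq0 k e W : enough_lines k W ->
  (forall w, w \in line_points W -> symbol (odd k) k e w = 0) ->
  forall l j, l \in W -> (column (odd k) k e j).[l.1%:~R] = 0.
Proof.
elim/last_ind: W => [|W l0 IH] // /and3P[Wu Wpos Wsize] W0.
have sub l : l \in W -> l \in rcons W l0.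
  by move=> lW; rewrite mem_rcons inE lW orbT.
have l0W : l0 \in rcons W l0 by rewrite mem_rcons mem_head.
move: Wu; rewrite /unzip1 map_rcons rcons_uniq => /andP[_ Wu].
move: Wpos; rewrite all_rcons => /andP[/andP[l0_gt0 l0u] Wpos].
have {}IH l j : l \in W -> (column (odd k) k e j).[l.1%:~R] = 0.
  apply: IH.
    rewrite /enough_lines /unzip1 Wu Wpos; apply/allP => i.
    rewrite mem_iota add0n leq0n andTb => iW; have /allP/(_ i) := Wsize.
    rewrite mem_iota size_rcons add0n leq0n andTb nth_rcons iW; apply.
    by rewrite ltnS ltnW.
  move=> w /allpairsPdep[l' [t [l'W tl' ->]]]; apply: W0.
  by apply/allpairsPdep; exists l', t; rewrite (sub _ l'W).
move=> l j; rewrite mem_rcons inE => /predU1P[->|]; last exact: IH.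
apply: (@line_columns _ _ _ _ l0.2) => //.
- move=> i Ti; apply: (@column_eq0 _ _ _ _ (unzip1 W)) => //.
  + by move=> _ /mapP[l' /(allP Wpos)/andP[l'_gt0 _] ->].
  + by move=> _ /mapP[l' l'W ->]; exact: IH.
  + have /allP/(_ (size W)) := Wsize.
    rewrite mem_iota size_rcons add0n leq0n andTb nth_rcons ltnn eqxx size_map.
    move=> /(_ (ltnSn _)) h; apply/orP; left.
    by apply: leq_trans h _; rewrite leq_add2r.
- move=> t tT; apply: W0; apply/allpairsPdep.
  by exists l0, t; rewrite l0W.
Qed.

Lemma parity_monomials_le b k d : odd d = b -> (d <= k <= d.+1)%N ->
  parity_monomials b k =i parity_monomials b d.
Proof.
move=> db /andP[dk kd] [i j]; rewrite !mem_parity_monomials.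
case: eqP => //= ijb; case: (0 < i + j)%N => //=.
apply/idP/idP => [ijk|ijd]; last exact: leq_trans dk.
have := leq_trans ijk kd; rewrite leq_eqVlt => /predU1P[ijd|//].
by move: ijb; rewrite ijd /= db; case: b {db}.
Qed.

(** The even part for odd k, and the odd part for even k, have degree k - 1;
    hence the effective degree d. *)
Lemma lines_unisolvent b k d e W : odd d = b -> (d <= k <= d.+1)%N ->
  enough_lines d W -> (d <= (size W).*2)%N ->
  (forall w, w \in line_points W -> symbol b k e w = 0) -> part_eq0 b k e.
Proof.
move=> db dk Wd dW W0 [i j].
rewrite (parity_monomials_le db dk) -db => ijd /=.
have := coef_column (odd d) d e i j; rewrite ijd => <-.
have {}W0 w : w \in line_points W -> symbol (odd d) d e w = 0.
  have kd : perm_eq (parity_monomials b d) (parity_monomials b k).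
    apply: uniq_perm; try exact/filter_uniq/monomials_uniq.
    by move=> ?; rewrite (parity_monomials_le db dk).
  by rewrite db /symbol (perm_big _ kd); exact: W0.
have -> : column (odd d) d e j = 0; last by rewrite coef0.
have /and3P[Wu /allP Wpos _] := Wd.
apply: (@column_eq0 _ _ _ _ (unzip1 W)) => //.
- by move=> _ /mapP[l /Wpos/andP[l_gt0 _] ->].
- by move=> _ /mapP[l lW ->]; exact: line_columns_eq0 Wd W0 _ _ lW.
- rewrite size_map; case: (posnP j) => [->|]; last by lia.
  by rewrite column0_root dW orbT.
Qed.

End Lines.

(** * Frequencies that determine the symbols *)

Definition lines3 : seq (int * seq int) := [:: (1, [:: -2; 0; 2])].

Definition lines5 : seq (int * seq int) :=
  [:: (1, [:: -2; -1; 0; 2; 3]); (2, [:: -1; 0; 2])].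

Definition lines6 : seq (int * seq int) :=
  [:: (1, [:: -3; -2; -1; 1; 2; 3]); (2, [:: -2; -1; 1; 2]); (3, [:: -1; 1])].

Definition freqs4 : seq freq := [:: (0, 1); (1, 0); (1, 1); (1, 2); (1, 3)].

Ltac expand_symbol b k H :=
  let m := eval vm_compute in (parity_monomials b k) in
  let E := fresh "E" in
  have E : parity_monomials b k = m by [vm_compute];
  rewrite /symbol E !big_cons big_nil in H; clear E;
  cbn [fst snd] in H.

Ltac expand_symbols b k H W :=
  lazymatch W with
  | cons ?w ?W' =>
    let h := fresh "h" in
    have h := H w isT; expand_symbol b k h; expand_symbols b k H W'
  | _ => idtac
  end.

(* The frequencies must stay written as ring expressions for the linear
   arithmetic, so they are unfolded by name rather than fully evaluated. *)
Ltac with_symbols b k H W tac :=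
  let l := eval cbv [cat line_points lines3 freqs4 flatten foldr map fst snd]
    in W in
  expand_symbols b k H l; clear H;
  let m := eval vm_compute in (parity_monomials b k) in
  let E := fresh "E" in
  have E : parity_monomials b k = m by [vm_compute];
  tac E.

Ltac linear_unisolvence b k H W :=
  with_symbols b k H W ltac:(fun E =>
    let ab := fresh "ab" in
    move=> ab; rewrite E; clear E;
    repeat (rewrite in_cons; case/orP; [move/eqP->; cbn [fst snd]; lra|]);
    by []).

Ltac linear_relation b k H W :=
  with_symbols b k H W ltac:(fun E =>
    rewrite /symbol E !big_cons !big_nil; clear E; cbn [fst snd]; lra).

Section Unisolvence.
Variable R : realType.
Implicit Type e : nat -> nat -> R.

Lemma even_unisolvent3 e :
  (forall w, w \in line_points lines3 -> symbol false 3 e w = 0) ->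
  part_eq0 false 3 e.
Proof. exact: (@lines_unisolvent _ false 3 2). Qed.

Lemma odd_unisolvent3 e :
  (forall w, w \in line_points lines3 ++ [:: (2, 0); (1, -1); (2, 2)] ->
    symbol true 3 e w = 0) -> part_eq0 true 3 e.
Proof.
move=> H; linear_unisolvence true 3%N H
  (line_points lines3 ++ [:: (2, 0); (1, -1); (2, 2)]).
Qed.

(** Here the frequencies are not arranged in complete lines; the linear system
    for the coefficients is solved directly, as for [odd_unisolvent3]. *)
Lemma even_unisolvent4 e :
  (forall w, w \in freqs4 ++ [:: (2, 0); (1, -2); (2, -2)] ->
    symbol false 4 e w = 0) -> part_eq0 false 4 e.
Proof.
move=> H; linear_unisolvence false 4%N H
  (freqs4 ++ [:: (2, 0); (1, -2); (2, -2)]).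
Qed.

Lemma odd_unisolvent4 e :
  (forall w, w \in freqs4 ++ [:: (2, 0)] ->
    symbol true 4 e w = 0) -> part_eq0 true 4 e.
Proof. by move=> H; linear_unisolvence true 4%N H (freqs4 ++ [:: (2, 0)]). Qed.

Lemma even_unisolvent5 e :
  (forall w, w \in line_points lines5 -> symbol false 5 e w = 0) ->
  part_eq0 false 5 e.
Proof. exact: (@lines_unisolvent _ false 5 4). Qed.

(** The lines s = 1 and s = 2 leave only the columns 0 and 1.  Column 1 is even
    of degree at most 4, and (0, 1) adds the root 0 to its roots 1, -1, 2 and -2;
    column 0 is odd of degree at most 5, and (3, 1) adds the root 3. *)
Lemma odd_unisolvent5 e :
  (forall w, w \in line_points lines5 ++ [:: (0, 1); (1, 1); (2, 1); (3, 1)] ->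
    symbol true 5 e w = 0) -> part_eq0 true 5 e.
Proof.
move=> H.
pose W : seq (int * seq int) :=
  [:: (1, 1 :: [:: -2; -1; 0; 2; 3]); (2, 1 :: [:: -1; 0; 2])].
have Wfull : enough_lines 5 W by [].
have W0 w : w \in line_points W -> symbol (odd 5) 5 e w = 0.
  by move=> wW; apply: H; move: w wW; apply/allP.
have W_col j (s : int) : s \in [:: 1; 2] -> (column true 5 e j).[s%:~R] = 0.
  rewrite !inE => /orP[] /eqP ->.
  - exact: (line_columns_eq0 Wfull W0 (l := nth (0, [::]) W 0)).
  - exact: (line_columns_eq0 Wfull W0 (l := nth (0, [::]) W 1)).
have S_gt0 (s : int) : s \in [:: 1; 2] -> 0 < s.
  by rewrite !inE => /orP[] /eqP ->.
have high j : (1 < j)%N -> column true 5 e j = 0.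
  move=> j1; apply: (@column_eq0 _ _ _ _ _ [:: 1; 2] isT S_gt0 (W_col j)).
  by rewrite /=; apply/orP; left; lia.
(* Evaluation at the second coordinate 1 adds up the columns. *)
have row1 (s : int) : symbol true 5 e (s, 1) =
    (column true 5 e 0).[s%:~R] + (column true 5 e 1).[s%:~R].
  rewrite symbol_columns 2!big_ord_recl big1 => [|j _].
    by rewrite addr0 !expr1n !mulr1.
  by rewrite [column _ _ _ _]high ?horner0 ?mul0r.
have col1 : column true 5 e 1 = 0.
  apply: (@column_eq0 _ _ _ _ _ [:: 1; 2] isT S_gt0 (W_col 1%N)).
  have := row1 0; rewrite H // (eqP (column0_root _ _ _)) add0r => <-.
  by rewrite eqxx.
have col0 : column true 5 e 0 = 0.
  apply: (@column_eq0 _ _ _ _ _ [:: 1; 2; 3]) => //.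
  - by move=> s; rewrite !inE => /or3P[] /eqP ->.
  - move=> s; rewrite (mem_cat s [:: 1; 2] [:: 3]) mem_seq1.
    case/orP=> [|/eqP ->]; first exact: W_col.
    by have := row1 3; rewrite H // col1 horner0 addr0 => <-.
move=> [i j] ijm /=; have := coef_column true 5 e i j; rewrite ijm => <-.
by case: j {ijm} => [|[|j]]; rewrite ?col0 ?col1 ?high // coef0.
Qed.

(** The three points (s, 0) complete the lines to 7, 5 and 3 points. *)
Lemma even_unisolvent6 e :
  (forall w, w \in line_points lines6 ++ [:: (1, 0); (2, 0); (3, 0)] ->
    symbol false 6 e w = 0) -> part_eq0 false 6 e.
Proof.
move=> H; pose W := [seq (l.1, 0 :: l.2) | l <- lines6].
apply: (@lines_unisolvent _ false 6 6 _ W) => // w wW.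
by apply: H; move: w wW; apply/allP.
Qed.

Lemma odd_unisolvent6 e :
  (forall w, w \in line_points lines6 -> symbol true 6 e w = 0) ->
  part_eq0 true 6 e.
Proof. exact: (@lines_unisolvent _ true 6 5). Qed.

(** The odd symbols of degree 3 that vanish on the points of [lines3] form a
    space of dimension 3, so their values at five points satisfy two relations. *)
Lemma odd_relations3 e :
  (forall w, w \in (line_points lines3) -> symbol true 3 e w = 0) ->
  symbol true 3 e (1, 1) = - symbol true 3 e (1, -1) /\
  3 * symbol true 3 e (3, 1) = 4 * symbol true 3 e (2, 2)
    + 8 * symbol true 3 e (2, 0) - 3 * symbol true 3 e (1, -1).
Proof. by move=> H; split; linear_relation true 3%N H (line_points lines3). Qed.

Lemma even_relation4 e :
  (forall w, w \in freqs4 -> symbol false 4 e w = 0) ->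
  symbol false 4 e (3, 0) = 6 * symbol false 4 e (2, 0).
Proof. by move=> H; linear_relation false 4%N H freqs4. Qed.

(** An odd cubic that vanishes at these five points is a multiple of X^3 - X. *)
Lemma odd_relations4 e :
  (forall w, w \in freqs4 -> symbol true 4 e w = 0) ->
  [/\ symbol true 4 e (3, 0) = 4 * symbol true 4 e (2, 0),
      symbol true 4 e (2, -2) = symbol true 4 e (2, 0)
    & symbol true 4 e (1, -2) = 0].
Proof. by move=> H; split; linear_relation true 4%N H freqs4. Qed.

End Unisolvence.

(** * The four maps *)

(** z = e^(i(3x + y)) + e^(2ix) + i e^(i(x - y)) and
    f = sin (2x + 2y) - cos (x + y). *)
Definition waves3 : seq (seq wave) :=
  exp_waves (line_points lines3) ++
  re_im [:: ((1, 0), (3, 1)); ((1, 0), (2, 0)); ((0, 1), (1, -1))] ++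
  [:: [:: ((0, -1), (2, 2)); ((-1, 0), (1, 1))]].

(** z1 = e^(2ix) + e^(i(x - 2y)) and z2 = e^(3ix) + i e^(i(2x - 2y)). *)
Definition waves4 : seq (seq wave) :=
  exp_waves freqs4 ++
  re_im [:: ((1, 0), (2, 0)); ((1, 0), (1, -2))] ++
  re_im [:: ((1, 0), (3, 0)); ((0, 1), (2, -2))].

(** z1 = e^(iy) (1 + e^(ix) + i e^(2ix)) and
    z2 = e^(iy) (e^(3ix) - i e^(ix) - e^(2ix)). *)
Definition waves5 : seq (seq wave) :=
  exp_waves (line_points lines5) ++
  re_im [:: ((1, 0), (0, 1)); ((1, 0), (1, 1)); ((0, 1), (2, 1))] ++
  re_im [:: ((1, 0), (3, 1)); ((0, -1), (1, 1)); ((-1, 0), (2, 1))].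

(** z = e^(3ix) - e^(2ix) - i e^(ix) and f = sin x + cos 2x: together, a closed
    space curve. *)
Definition waves6 : seq (seq wave) :=
  exp_waves (line_points lines6) ++
  re_im [:: ((1, 0), (3, 0)); ((-1, 0), (2, 0)); ((0, -1), (1, 0))] ++
  [:: [:: ((0, -1), (1, 0)); ((1, 0), (2, 0))]].

Section Free.
Variable R : realType.
Implicit Types (x v : 'rV[R]_2) (w : freq) (z : seq wave) (e : nat -> nat -> R).

Lemma sin2Dcos2_gt0 (t : R) : 0 < sin t ^+ 2 + cos (t *+ 2) ^+ 2.
Proof.
rewrite lt0r paddr_eq0 ?sqr_ge0 // addr_ge0 ?sqr_ge0 // andbT !expf_eq0 /=.
apply/negP => /andP[/eqP s0]; rewrite cos_mulr2n cos2sin2 s0 => /eqP; lra.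
Qed.

(** The matrix of this system is a rotation times a positive scalar. *)
Lemma rotation_eq0 (t a b : R) : sin t * a + cos (t *+ 2) * b = 0 ->
  cos (t *+ 2) * a = sin t * b -> a = 0 /\ b = 0.
Proof.
set s := sin t; set c := cos _ => h1 h2.
have q0 : s ^+ 2 + c ^+ 2 != 0 by rewrite gt_eqF // sin2Dcos2_gt0.
split; apply: (mulfI q0); rewrite mulr0.
- transitivity (s * (s * a + c * b) + c * (c * a - s * b)); first ring.
  by rewrite h1 h2 subrr !mulr0 addr0.
- transitivity (c * (s * a + c * b) - s * (c * a - s * b)); first ring.
  by rewrite h1 h2 subrr !mulr0 subr0.
Qed.

(** With t = x + y, s = sin t, c2 = cos 2t and a, b, d the values of O at (2, 0),
    (1, -1) and (2, 2), the components z and f give s a = c2 b and c2 d = s b,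
    and one equation for O(3, 1).  The relations between the values of O turn
    the latter into a relation between a, b and d; multiplied by c2, it reads
    Q r = 0 when a = c2 r and b = s r, where Q > 0. *)
Lemma waves3_free : symbol_free R 3 waves3.
Proof.
move=> x e /annihilated_cat[/annihilated_exp S0 /annihilated_cat[zv fv]].
have E0 : part_eq0 false 3 e by apply: even_unisolvent3 => w; exact: S0.
have O0 w : w \in (line_points lines3) -> symbol true 3 e w = 0 by exact: S0.
apply: coef_eq0 => //; apply: odd_unisolvent3.
have [r11 r31] := odd_relations3 O0.
pose t := phase (1, 1) x.
have [h1 h2] := annihilated_re_im (phase (3, 1) x) zv.
have h3 := fv _ (mem_head _ _).
move: h1 h2 h3; rewrite symbol_actE !big_cons !big_nil /re_coef /im_coef.
cbn [fst snd]; rewrite !(symbol_eq0 _ E0) !mul0r.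
have -> : phase (3, 1) x - phase (3, 1) x = 0 by rewrite subrr.
have -> : phase (2, 0) x - phase (3, 1) x = - t by rewrite /t /phase /=; ring.
have -> : phase (1, -1) x - phase (3, 1) x = - (t *+ 2).
  by rewrite /t /phase /=; ring.
have -> : phase (2, 2) x = t *+ 2 by rewrite /t /phase /=; ring.
rewrite -/t !cosN !sinN cos0 sin0 r11 => h1 h2 h3.
have := sin2Dcos2_gt0 t; have := sin_geN1 (t *+ 2); have := sin_le1 (t *+ 2).
have := cos_geN1 t.
set s := sin t in h1 h2 h3 *; set c := cos t in h1 h2 h3 *.
set c2 := cos (t *+ 2) in h1 h2 h3 *; set s2 := sin (t *+ 2) in h1 h2 h3 *.
set a := symbol true 3 e (2, 0) in r31 h1 h2 h3 *.
set b := symbol true 3 e (1, -1) in r31 h1 h2 h3 *.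
set d := symbol true 3 e (2, 2) in r31 h1 h2 h3 *.
move=> c_ge s2_le s2_ge q_gt0.
have {h1} ab : s * a = c2 * b by lra.
have {h3} db : c2 * d = s * b by lra.
have {h2 r31} rel : 4 * d + (8 + 3 * c) * a - 3 * (1 - s2) * b = 0 by lra.
pose Q := 4 * s ^+ 2 + (8 + 3 * c) * c2 ^+ 2 - 3 * (1 - s2) * (s * c2).
(* Since cos t >= -1 and 0 <= 1 - sin 2t <= 2, Q >= s^2 + 2 c2^2. *)
have Q_gt0 : 0 < Q.
  have p1 : 0 <= (c + 1) * c2 ^+ 2 by rewrite mulr_ge0 ?sqr_ge0 //; lra.
  have p2 : 0 <= (1 - s2) * (s - c2) ^+ 2 by rewrite mulr_ge0 ?sqr_ge0 //; lra.
  have p3 : 0 <= (1 + s2) * (s ^+ 2 + c2 ^+ 2).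
    by rewrite mulr_ge0 ?(ltW q_gt0) //; lra.
  have p4 : 0 <= c2 ^+ 2 by exact: sqr_ge0.
  rewrite /Q; lra.
have b0 : b = 0.
  apply: (mulfI (lt0r_neq0 Q_gt0)); rewrite mulr0.
  transitivity (s * (4 * (s * b) + (8 + 3 * c) * (c2 * a)
      - 3 * (1 - s2) * (c2 * b))
    + (8 + 3 * c) * c2 * (c2 * b - s * a)); first by rewrite /Q; ring.
  rewrite -db ab subrr mulr0 addr0.
  transitivity (s * (c2 * (4 * d + (8 + 3 * c) * a - 3 * (1 - s2) * b))).
    by ring.
  by rewrite rel !mulr0.
have a0 : a = 0.
  apply: (mulfI (lt0r_neq0 Q_gt0)); rewrite mulr0.
  have -> : Q * a = 4 * s * (s * a) + (8 + 3 * c) * c2 * (c2 * a)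
     - 3 * (1 - s2) * c2 * (s * a) by rewrite /Q; ring.
  move: rel; rewrite b0 mulr0 subr0 => rel; rewrite ab b0 !mulr0.
  transitivity (c2 * c2 * (4 * d + (8 + 3 * c) * a) - 4 * c2 * (c2 * d)).
    by ring.
  by rewrite rel db b0 !mulr0 subr0.
move=> w; rewrite mem_cat => /orP[/O0 //|]; rewrite !inE.
case/or3P => /eqP -> //.
move: rel; rewrite a0 b0 -/d; lra.
Qed.

(** With t = x + 2y, z1 expresses E and O at (2, 0) by E(1, -2); eliminating
    E(2, -2) from the two equations of z2 leaves
    (6 cos^2 t + 4 sin^2 t + sin t) E(1, -2) = 0. *)
Lemma waves4_free : symbol_free R 4 waves4.
Proof.
move=> x e /annihilated_cat[/annihilated_exp S0 /annihilated_cat[z1v z2v]].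
have E0 w : w \in freqs4 -> symbol false 4 e w = 0 by exact: S0.
have O0 w : w \in freqs4 -> symbol true 4 e w = 0 by exact: S0.
have [r30 r22 r12] := odd_relations4 O0.
have E30 := even_relation4 E0.
pose t := phase (1, 2) x.
have [h1 h2] := annihilated_re_im (phase (2, 0) x) z1v.
have [h3 h4] := annihilated_re_im (phase (3, 0) x) z2v.
move: h1 h2 h3 h4; rewrite !big_cons !big_nil /re_coef /im_coef.
cbn [fst snd].
have -> : phase (1, -2) x - phase (2, 0) x = - t by rewrite /t /phase /=; ring.
have -> : phase (2, -2) x - phase (3, 0) x = - t by rewrite /t /phase /=; ring.
rewrite !subrr !cosN !sinN cos0 sin0 r30 E30 r22 r12 => h1 h2 h3 h4.
have := cos2Dsin2 t; have := sin_geN1 t; have := sin_le1 t.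
set s := sin t in h1 h2 h3 h4 *; set c := cos t in h1 h2 h3 h4 *.
move: h1 h2 h3 h4.
set E20 := symbol false 4 e (2, 0); set O20 := symbol true 4 e (2, 0).
set E12 := symbol false 4 e (1, -2); set E22 := symbol false 4 e (2, -2).
move=> h1 h2 h3 h4 s_le s_ge cs.
have {}h1 : E20 = - (E12 * c) by lra.
have {}h2 : O20 = E12 * s by lra.
have {}h3 : 6 * E20 - O20 * c + E22 * s = 0 by lra.
have {}h4 : 4 * O20 + O20 * s + E22 * c = 0 by lra.
have E120 : E12 = 0.
  have Q_gt0 : 0 < 6 * c ^+ 2 + 4 * s ^+ 2 + s by nra.
  apply: (mulfI (lt0r_neq0 Q_gt0)); rewrite mulr0.
  transitivity (- (c * (6 * E20 - O20 * c + E22 * s)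
    - s * (4 * O20 + O20 * s + E22 * c)) + s * (1 - (c ^+ 2 + s ^+ 2)) * E12).
    by rewrite h1 h2; ring.
  by rewrite h3 h4 cs; ring.
have E200 : E20 = 0 by rewrite h1 E120 mul0r oppr0.
have O200 : O20 = 0 by rewrite h2 E120 mul0r.
have E220 : E22 = 0.
  transitivity ((c ^+ 2 + s ^+ 2) * E22); first by rewrite cs mul1r.
  transitivity (c * (4 * O20 + O20 * s + E22 * c)
    + s * (6 * E20 - O20 * c + E22 * s)).
    by rewrite E200 O200; ring.
  by rewrite h3 h4; ring.
apply: coef_eq0; [apply: even_unisolvent4|apply: odd_unisolvent4] => w;
  rewrite mem_cat => /orP[/S0 //|]; rewrite !inE.
- by case/or3P => /eqP ->.
- by move=> /eqP ->.
Qed.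

(** With t = x, the real parts of the conditions for z1, divided by e^(iy), and
    for z2, divided by e^(i(3x + y)), only involve O(1, 1) and O(2, 1), and form
    the system of [rotation_eq0]; the imaginary parts then give O(0, 1) and
    O(3, 1). *)
Lemma waves5_free : symbol_free R 5 waves5.
Proof.
move=> x e /annihilated_cat[/annihilated_exp S0 /annihilated_cat[z1v z2v]].
have E0 : part_eq0 false 5 e by apply: even_unisolvent5 => w; exact: S0.
apply: coef_eq0 => //; apply: odd_unisolvent5.
pose t := phase (1, 0) x.
have [h1 h2] := annihilated_re_im (phase (0, 1) x) z1v.
have [h3 h4] := annihilated_re_im (phase (3, 1) x) z2v.
move: h1 h2 h3 h4; rewrite !big_cons !big_nil /re_coef /im_coef.
cbn [fst snd]; rewrite !(symbol_eq0 _ E0) !mul0r.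
have -> : phase (1, 1) x - phase (0, 1) x = t by rewrite /t /phase /=; ring.
have -> : phase (2, 1) x - phase (0, 1) x = t *+ 2 by rewrite /t /phase /=; ring.
have -> : phase (1, 1) x - phase (3, 1) x = - (t *+ 2).
  by rewrite /t /phase /=; ring.
have -> : phase (2, 1) x - phase (3, 1) x = - t by rewrite /t /phase /=; ring.
rewrite !subrr !cosN !sinN cos0 sin0 => h1 h2 h3 h4.
have [r11 r21] : symbol true 5 e (1, 1) = 0 /\ symbol true 5 e (2, 1) = 0.
  by apply: (@rotation_eq0 t); lra.
move: h2 h4; rewrite r11 r21 => h2 h4.
move=> w; rewrite mem_cat => /orP[/S0 //|]; rewrite !inE.
by case/or4P => /eqP -> //; lra.
Qed.

(** With t = x, the condition for f and the imaginary part of the one for z,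
    divided by e^(3ix), only involve E(1, 0) and E(2, 0), and form the system of
    [rotation_eq0]; the real part then gives E(3, 0). *)
Lemma waves6_free : symbol_free R 6 waves6.
Proof.
move=> x e /annihilated_cat[/annihilated_exp S0 /annihilated_cat[zv fv]].
have O0 : part_eq0 true 6 e by apply: odd_unisolvent6 => w; exact: S0.
apply: coef_eq0 => //; apply: even_unisolvent6.
pose t := phase (1, 0) x.
have [h1 h2] := annihilated_re_im (phase (3, 0) x) zv.
have h3 := fv _ (mem_head _ _).
move: h1 h2 h3; rewrite symbol_actE !big_cons !big_nil /re_coef /im_coef.
cbn [fst snd]; rewrite !(symbol_eq0 _ O0) !mul0r.
have -> : phase (2, 0) x - phase (3, 0) x = - t by rewrite /t /phase /=; ring.
have -> : phase (1, 0) x - phase (3, 0) x = - (t *+ 2).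
  by rewrite /t /phase /=; ring.
have -> : phase (2, 0) x = t *+ 2 by rewrite /t /phase /=; ring.
rewrite !subrr -/t !cosN !sinN cos0 sin0 => h1 h2 h3.
have [E1 E2] : symbol false 6 e (1, 0) = 0 /\ symbol false 6 e (2, 0) = 0.
  by apply: (@rotation_eq0 t); lra.
move: h1; rewrite E1 E2 => h1.
move=> w; rewrite mem_cat => /orP[/S0 //|]; rewrite !inE.
by case/or3P => /eqP -> //; lra.
Qed.

End Free.

Theorem mainTheorem2 (R : realType) (k : nat) (hk : k \in [:: 3; 4; 5; 6]%N) :
  exists F : torus R 2 -> 'rV[R]_('C(k + 2, k) - 1)%N,
    [/\ torus_smooth F, torus_immersion F & torus_kfree k F].
Proof.
move: hk; rewrite !inE => /or4P[] /eqP ->.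
- exists (torus_trig_map _ waves3); exact: torus_kfree_trig (@waves3_free R) _.
- exists (torus_trig_map _ waves4); exact: torus_kfree_trig (@waves4_free R) _.
- exists (torus_trig_map _ waves5); exact: torus_kfree_trig (@waves5_free R) _.
- exists (torus_trig_map _ waves6); exact: torus_kfree_trig (@waves6_free R) _.
Qed.
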